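(* Let $K_i=[0,b_i,c_i,d_i]$, $i=1,2,3$, be three oriented lines (so $b_i^2+c_i^2=1$). Consider the isogonal version of the Apollonius problem: to find the oriented circles $K_0=[a_0,b_0,c_0,d_0]$ with $1-2Q(K_i,K_0)=\cos\Psi_0$ for $i=1,2,3$, where $\cos\Psi_0$ is the real parameter of the family. Solutions exist if $\Delta_1\ne0$ and $\Delta_{bc}\ne0$, and they are given by $$a_0=\frac{2\Delta_{bc}\cos\Psi_0}{\Delta_1},\qquad b_0=-\frac{\Delta_{cd}\cos\Psi_0}{\Delta_1},\qquad c_0=\frac{\Delta_{bd}\cos\Psi_0}{\Delta_1},\qquad d_0=\frac{b_0^2+c_0^2-1}{a_0}.$$ This is a pencil of concentric circles with centre at the point $\left(\dfrac{\Delta_{cd}}{2\Delta_{bc}},\,-\dfrac{\Delta_{bd}}{2\Delta_{bc}}\right)$.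
   Context: An oriented circle or line is a quadruple of reals $K=[a,b,c,d]$ with $b^2+c^2-ad=1$, representing the curve $N(x,y)=a(x^2+y^2)+2bx+2cy+d=0$. Here $a$ is its signed curvature: for $a\ne0$ it is the circle of radius $1/|a|$ centred at $(-b/a,-c/a)$, for $a=0$ it is a straight line. The orientation is such that points with $N<0$ lie to the left of the curve. The oriented line through $(x_i,y_i)$ with direction angle $\tau_i$ has $b_i=\sin\tau_i$, $c_i=-\cos\tau_i$, $d_i=2y_i\cos\tau_i-2x_i\sin\tau_i$. The inversive invariant of two oriented circles or lines is defined by $4Q(K_1,K_2)=2+a_1d_2+a_2d_1-2(b_1b_2+c_1c_2)$; their intersection angle $\Psi$ (real or imaginary) is given by $\cos\Psi=1-2Q(K_1,K_2)$. Thus $\Psi_0$ is the common angle of $K_0$ with the three lines; imaginary values of $\Psi_0$, with $|\cos\Psi_0|>1$, are included in the family. Writing $\det(p_i\ q_i\ r_i)$ for the $3\times3$ determinant whose $i$-th row is $(p_i,q_i,r_i)$, $i=1,2,3$: $\Delta_1=-\det(b_i\ c_i\ d_i)$, $\Delta_{bc}=\det(b_i\ c_i\ 1)$, $\Delta_{bd}=\det(b_i\ d_i\ 1)$, $\Delta_{cd}=\det(c_i\ d_i\ 1)$.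
   Formalization: Existence and the formulas are stated for cos Ψ₀ ≠ 0: at cos Ψ₀ = 0 they give a₀ = b₀ = c₀ = 0, so d₀ is undefined and b₀²+c₀²−a₀d₀ = 1 fails; it is proved instead that no solution exists there. *)

(* Defs.v *)
From HB Require Import structures.
From mathcomp Require Import all_boot all_order all_algebra.
From mathcomp Require Import reals.
From mathcomp Require Import ring lra.

Set Implicit Arguments.
Unset Strict Implicit.
Unset Printing Implicit Defensive.

Import Order.TTheory GRing.Theory Num.Theory.
Local Open Scope ring_scope.

Record quad (R : Type) := Quad { qa : R; qb : R; qc : R; qd : R }.

Section OrientedCircles.
Variable R : realType.
Implicit Types (K : quad R) (b c d p q r : 'I_3 -> R).

(* K is an oriented circle (qa K != 0) or an oriented line (qa K = 0). *)
Definition oriented K : Prop := qb K ^+ 2 + qc K ^+ 2 - qa K * qd K = 1.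

(* The curve represented by K is the zero locus of N K. *)
Definition N K (x y : R) : R :=
  qa K * (x ^+ 2 + y ^+ 2) + 2 * qb K * x + 2 * qc K * y + qd K.

Definition is_circle K : Prop := oriented K /\ qa K != 0.

(* Meaningful only when qa K != 0; see N_eq0_circle below. *)
Definition centre K : R * R := (- qb K / qa K, - qc K / qa K).

Lemma N_eq0_circle K (x y : R) : is_circle K ->
  N K x y = 0 <->
  Num.sqrt ((x - (centre K).1) ^+ 2 + (y - (centre K).2) ^+ 2) = 1 / `|qa K|.
Proof.
case: K => a b c d [] /=; rewrite /oriented /N /= => oK a0.
set s := (X in Num.sqrt X).
have s0 : 0 <= s by rewrite addr_ge0 ?sqr_ge0.
have aa0 : 0 <= 1 / `|a| by rewrite divr_ge0.
have sE : a * (a * (x ^+ 2 + y ^+ 2) + 2 * b * x + 2 * c * y + d)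
    = a ^+ 2 * s - 1.
  transitivity (a ^+ 2 * s - (b ^+ 2 + c ^+ 2 - a * d)); last by rewrite oK.
  by rewrite /s; field.
have a20 : a ^+ 2 != 0 by rewrite expf_neq0.
split=> [N0|sqE].
  have s1 : s = (1 / `|a|) ^+ 2.
    rewrite expr_div_n expr1n real_normK ?num_real //.
    apply: (mulfI a20); rewrite mulrCA mulfV // mulr1.
    by apply/eqP; rewrite -subr_eq0 -sE N0 mulr0.
  by rewrite s1 sqrtr_sqr ger0_norm.
apply: (mulfI a0); rewrite sE mulr0 -(sqr_sqrtr s0) sqE.
by rewrite expr_div_n expr1n real_normK ?num_real // mulrCA mulfV // mulr1 subrr.
Qed.

(* Inversive invariant, normalised so that
   4Q = 2 + a1 d2 + a2 d1 - 2 (b1 b2 + c1 c2). *)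
Definition Q K1 K2 : R :=
  (2 + qa K1 * qd K2 + qa K2 * qd K1
     - 2 * (qb K1 * qb K2 + qc K1 * qc K2)) / 4.

(* Cosine of the real or imaginary intersection angle: any real number is a
   possible value, and no angle is attached to it when it exceeds 1 in absolute
   value. *)
Definition cos_angle K1 K2 : R := 1 - 2 * Q K1 K2.

Definition line (b c d : R) : quad R := Quad 0 b c d.

Definition isogonal (K : 'I_3 -> quad R) (cosPsi : R) (K0 : quad R) : Prop :=
  oriented K0 /\ forall i, cos_angle (K i) K0 = cosPsi.

Definition det3 p q r : R :=
  \det (\matrix_(i < 3, j < 3) [:: p i; q i; r i]`_j).

Definition Delta1 b c d : R := - det3 b c d.
Definition Delta_bc b c : R := det3 b c (fun=> 1).
Definition Delta_bd b d : R := det3 b d (fun=> 1).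
Definition Delta_cd c d : R := det3 c d (fun=> 1).

End OrientedCircles.

(* Main.v *)
Require Import Defs.
From HB Require Import structures.
From mathcomp Require Import all_boot all_order all_algebra.
From mathcomp Require Import reals.
From mathcomp Require Import ring.

Set Implicit Arguments.
Unset Strict Implicit.
Unset Printing Implicit Defensive.

Import Order.TTheory GRing.Theory Num.Theory.
Local Open Scope ring_scope.

(** Against a straight line the cosine of the intersection angle is linear in
    the unknown circle: it is [b_i b0 + c_i c0 + d_i (- a0 / 2)]. The three angle
    conditions therefore form a linear system in [(b0, c0, - a0 / 2)] with matrix
    [(b_i c_i d_i)], invertible since its determinant is [- Delta1], and with
    constant right-hand side [cosPsi]. Cramer's rule ([cramer3]) gives the stated
    [a0], [b0], [c0], after moving the column of ones to the end
    ([isogonal_linesP]). The normalisation [b0^2 + c0^2 - a0 d0 = 1] then gives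
    [d0], provided [a0 != 0], that is [cosPsi != 0] and [Delta_bc != 0]. For
    [cosPsi = 0] the system forces [a0 = b0 = c0 = 0], which contradicts the
    normalisation.

    All of [a0], [b0], [c0] are proportional to [cosPsi], so the centre
    [(- b0 / a0, - c0 / a0)] does not depend on it. Conversely, a circle with that
    centre is the member of the family whose parameter is recovered from its
    curvature, [cosPsi = a0 Delta1 / (2 Delta_bc)]. *)

Lemma ord3P (i : 'I_3) : [\/ i = 0, i = 1 | i = 2].
Proof.
by case: i => [[|[|[|m]]] Hi] //;
  [apply: Or31|apply: Or32|apply: Or33]; apply: val_inj.
Qed.

Section Pencil.
Variable R : realType.
Implicit Types (p q r b c d : 'I_3 -> R).

Lemma det3E p q r :
  det3 p q r = p 0 * (q 1 * r 2 - q 2 * r 1)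
             - q 0 * (p 1 * r 2 - p 2 * r 1)
             + r 0 * (p 1 * q 2 - p 2 * q 1).
Proof.
rewrite /det3 (expand_det_row _ 0) !big_ord_recl big_ord0.
rewrite /cofactor !(expand_det_row _ 0) !big_ord_recl !big_ord0.
rewrite /cofactor !det_mx11 !mxE /=.
have -> : lift 0 0 = 1 :> 'I_3 by apply: val_inj.
have -> : lift 0 (lift 0 0) = 2 :> 'I_3 by apply: val_inj.
rewrite /=; ring.
Qed.

Lemma cramer3 b c d r (x y z : R) : det3 b c d != 0 ->
  (forall i, b i * x + c i * y + d i * z = r i) <->
  [/\ x = det3 r c d / det3 b c d,
      y = det3 b r d / det3 b c d
    & z = det3 b c r / det3 b c d].
Proof.
move=> D0; split=> [sys|[-> -> ->] i].
  by split; apply: (canRL (mulfK D0)); rewrite !det3E -!sys; ring.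
(* A 4 x 4 determinant with a repeated row vanishes; expand it along that row. *)
have lap : b i * det3 r c d + c i * det3 b r d + d i * det3 b c r
           = r i * det3 b c d.
  by rewrite !det3E; case: (ord3P i) => ->; ring.
by rewrite !mulrA -!mulrDl lap mulfK.
Qed.

Lemma cos_angle_line (b c d : R) (K0 : quad R) :
  cos_angle (line b c d) K0 = b * qb K0 + c * qc K0 + d * - (qa K0 / 2).
Proof. by rewrite /cos_angle /Q /line /=; field. Qed.

(** The angle conditions determine [a0], [b0] and [c0], whatever the value of
    [cosPsi]; the division by [a0] that yields [d0] is kept out of this form. *)
Lemma isogonal_linesP b c d (cosPsi : R) (K0 : quad R) :
  Delta1 b c d != 0 ->
  isogonal (fun i => line (b i) (c i) (d i)) cosPsi K0 <->
  [/\ oriented K0,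
      qa K0 = 2 * Delta_bc b c * cosPsi / Delta1 b c d,
      qb K0 = - (Delta_cd c d * cosPsi / Delta1 b c d)
    & qc K0 = Delta_bd b d * cosPsi / Delta1 b c d].
Proof.
move=> D10; have D0 : det3 b c d != 0 by rewrite -oppr_eq0.
have xE : det3 (fun=> cosPsi) c d / det3 b c d
          = - (Delta_cd c d * cosPsi / Delta1 b c d).
  have -> : det3 (fun=> cosPsi) c d = Delta_cd c d * cosPsi.
    by rewrite /Delta_cd !det3E; ring.
  by rewrite /Delta1 invrN mulrN opprK.
have yE : det3 b (fun=> cosPsi) d / det3 b c d
          = Delta_bd b d * cosPsi / Delta1 b c d.
  have -> : det3 b (fun=> cosPsi) d = - (Delta_bd b d * cosPsi).
    by rewrite /Delta_bd !det3E; ring.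
  by rewrite /Delta1 invrN mulrN mulNr.
have zE : det3 b c (fun=> cosPsi) / det3 b c d
          = - (2 * Delta_bc b c * cosPsi / Delta1 b c d / 2).
  have -> : det3 b c (fun=> cosPsi) = Delta_bc b c * cosPsi.
    by rewrite /Delta_bc !det3E; ring.
  by rewrite /Delta1; field.
have sysP := cramer3 (fun=> cosPsi) (qb K0) (qc K0) (- (qa K0 / 2)) D0.
rewrite xE yE zE in sysP.
split=> [[oK0 ang]|[oK0 aE bE cE]].
  have /sysP[bE cE aE] i : b i * qb K0 + c i * qc K0 + d i * - (qa K0 / 2)
                           = cosPsi by rewrite -cos_angle_line.
  split=> //; apply: (@mulIf _ 2^-1); first by rewrite invr_eq0 pnatr_eq0.
  exact: oppr_inj.
split=> // i; rewrite cos_angle_line; move: i; apply/sysP.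
by split=> //; rewrite aE.
Qed.

Lemma orientedP (K0 : quad R) : qa K0 != 0 ->
  oriented K0 <-> qd K0 = (qb K0 ^+ 2 + qc K0 ^+ 2 - 1) / qa K0.
Proof.
move=> a0; rewrite /oriented; split=> [<-|->]; last by field.
by field.
Qed.

End Pencil.

Theorem mainTheorem6 (R : realType) (b c d : 'I_3 -> R)
    (lines : forall i, oriented (line (b i) (c i) (d i)))
    (Delta1_neq0 : Delta1 b c d != 0)
    (Delta_bc_neq0 : Delta_bc b c != 0) :
  let K := fun i : 'I_3 => line (b i) (c i) (d i) in
  [/\ forall cosPsi : R, cosPsi != 0 -> exists K0, isogonal K cosPsi K0,
      forall (cosPsi : R) (K0 : quad R), cosPsi != 0 ->
        isogonal K cosPsi K0 <->
        [/\ qa K0 = 2 * Delta_bc b c * cosPsi / Delta1 b c d,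
            qb K0 = - (Delta_cd c d * cosPsi / Delta1 b c d),
            qc K0 = Delta_bd b d * cosPsi / Delta1 b c d
          & qd K0 = (qb K0 ^+ 2 + qc K0 ^+ 2 - 1) / qa K0],
      forall K0 : quad R, ~ isogonal K 0 K0
    & forall K0 : quad R,
        (exists cosPsi : R, isogonal K cosPsi K0) <->
        is_circle K0 /\
        centre K0 = (Delta_cd c d / (2 * Delta_bc b c),
                     - (Delta_bd b d / (2 * Delta_bc b c)))].
Proof.
move=> K.
have a_neq0 t : t != 0 -> 2 * Delta_bc b c * t / Delta1 b c d != 0.
  by move=> t0; rewrite !mulf_neq0 ?invr_eq0 ?pnatr_eq0.
have famP t K0 : t != 0 -> isogonal K t K0 <->
    [/\ qa K0 = 2 * Delta_bc b c * t / Delta1 b c d,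
        qb K0 = - (Delta_cd c d * t / Delta1 b c d),
        qc K0 = Delta_bd b d * t / Delta1 b c d
      & qd K0 = (qb K0 ^+ 2 + qc K0 ^+ 2 - 1) / qa K0].
  move=> t0; split=> [/(isogonal_linesP _ _ Delta1_neq0)[oK0 aE bE cE]|].
    by split=> //; apply/orientedP => //; rewrite aE a_neq0.
  case=> aE bE cE dE; apply/isogonal_linesP => //.
  by split=> //; apply/orientedP => //; rewrite aE a_neq0.
have no0 K0 : ~ isogonal K 0 K0.
  case/(isogonal_linesP _ _ Delta1_neq0).
  rewrite /oriented !mulr0 !mul0r oppr0 => oK0 aE bE cE.
  move: oK0; rewrite aE bE cE mul0r expr0n /= addr0 subr0 => /esym/eqP.
  by rewrite oner_eq0.
split=> // [t t0|K0].
  set a0 := 2 * Delta_bc b c * t / Delta1 b c d.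
  set b0 := - (Delta_cd c d * t / Delta1 b c d).
  set c0 := Delta_bd b d * t / Delta1 b c d.
  by exists (Quad a0 b0 c0 ((b0 ^+ 2 + c0 ^+ 2 - 1) / a0)); apply/famP.
split=> [[t iK0]|[[oK0 a0] [bE cE]]].
  have t0 : t != 0 by apply/eqP => t0; apply: (no0 K0); rewrite -t0.
  have [oK0 aE bE cE] := (isogonal_linesP t K0 Delta1_neq0).1 iK0.
  split; first by split=> //; rewrite aE a_neq0.
  by rewrite /centre aE bE cE; congr pair; field;
    rewrite Delta_bc_neq0 t0 Delta1_neq0.
exists (qa K0 * Delta1 b c d / (2 * Delta_bc b c)).
apply/isogonal_linesP => //; split=> //.
- by field; rewrite Delta_bc_neq0 Delta1_neq0.
- have -> : qb K0 = - (qa K0 * (- qb K0 / qa K0)) by field.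
  by rewrite bE; field; rewrite Delta_bc_neq0 Delta1_neq0.
- have -> : qc K0 = - (qa K0 * (- qc K0 / qa K0)) by field.
  by rewrite cE; field; rewrite Delta_bc_neq0 Delta1_neq0.
Qed.
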